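(* Let $\mathbf{K}=(K,+,;,\rightarrow,0,1)$ and $\mathbf{T}=(T,+,;,\rightarrow,0,1)$ be complete residuated lattices with $T\subseteq K$, where the join, multiplication, $0$ and $1$ of $\mathbf{T}$ are the restrictions of those of $\mathbf{K}$, and suppose $a;b=b;a$ and $a;a=a$ for all $a,b\in T$. Let $\Sigma$ be an alphabet. Then $\mathbf{FLANG}(\mathbf{K},\mathbf{T})=(K^{\Sigma^*},T^{\Sigma^*}_{\epsilon},\cup,\cdot,{}^*,\rightarrow,\varnothing,\epsilon)$ is an idempotent graded Kleene algebra with tests (I-GKAT).
   Context: A complete residuated lattice $(W,+,;,\rightarrow,0,1)$ is a complete lattice on $W$ with binary join $+$ (arbitrary joins written $\sum$), least element $0$ and greatest element $1$, together with an associative multiplication $;$ having $1$ as two-sided unit and distributing over arbitrary joins on both sides, and a binary operation $\rightarrow$ with $a;b\leq c\Leftrightarrow b\leq a\rightarrow c$. $\Sigma^*$ is the set of finite words over $\Sigma$, with empty word also written $\epsilon$. $K^{\Sigma^*}$ is the set of functions $\Sigma^*\to K$ (fuzzy languages); $T^{\Sigma^*}_{\epsilon}$ is the set of functions $\iota:\Sigma^*\to T$ with $\iota(w)=0$ for every nonempty word $w$. Operations: $(\lambda_1\cup\lambda_2)(w)=\lambda_1(w)+\lambda_2(w)$; $(\lambda_1\cdot\lambda_2)(w)=\sum_{w=uv}\lambda_1(u);\lambda_2(v)$, the join over all factorizations $w=uv$ with $u,v\in\Sigma^*$ (possibly empty); $\lambda^*(w)=\sum_{k\geq0}\lambda^k(w)$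 with $\lambda^0=\epsilon$, $\lambda^{k+1}=\lambda^k\cdot\lambda$; for $\iota_1,\iota_2\in T^{\Sigma^*}_\epsilon$: $(\iota_1\rightarrow\iota_2)(\epsilon)=\iota_1(\epsilon)\rightarrow\iota_2(\epsilon)$ (residuum of $\mathbf{T}$) and $(\iota_1\rightarrow\iota_2)(w)=0$ for $w\neq\epsilon$; $\varnothing(w)=0$; $\epsilon(w)=1$ if $w$ is the empty word and $0$ otherwise. A GKAT is a tuple $(K',T',+,;,{}^*,\rightarrow,0,1)$ where $K'$ is a set, $T'\subseteq K'$, $0,1\in T'$, $+$ and $;$ are binary operations on $K'$ under which $T'$ is closed, ${}^*$ is unary on $K'$, and $\rightarrow$ is a binary operation on $T'$ with values in $T'$, such that for all $p,q,r\in K'$ and $a,b,c\in T'$: $p+(q+r)=(p+q)+r$; $p+q=q+p$; $p;(q;r)=(p;q);r$; $p;1=1;p=p$; $p;(q+r)=p;q+p;r$; $(p+q);r=p;r+q;r$; $p;0=0;p=0$; $1+p;p^*=p^*$; $q+p;r\leq r\Rightarrow p^*;q\leq r$; $q+r;p\leq r\Rightarrow q;p^*\leq r$; $a;b\leq c\Leftrightarrow b\leq a\rightarrow c$; $a\leq 1$; $a;b=b;a$, where $p\leq q$ means $p+q=q$. An I-GKAT is a GKAT additionally satisfying $a;a=a$ for all $a\in T'$. *)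

(* Defs.v *)
From mathcomp Require Import all_boot.
From mathcomp Require Import boolp classical_sets.

Set Implicit Arguments.
Unset Strict Implicit.
Unset Printing Implicit Defensive.

Local Open Scope classical_set_scope.

Definition join_le (W : Type) (add : W -> W -> W) (x y : W) : Prop :=
  add x y = y.

Definition is_least_upper_bound (W : Type) (le : W -> W -> Prop)
    (A : set W) (s : W) : Prop :=
  (forall x, A x -> le x s) /\
  (forall y, (forall x, A x -> le x y) -> le s y).

Definition is_greatest_lower_bound (W : Type) (le : W -> W -> Prop)
    (A : set W) (m : W) : Prop :=
  (forall x, A x -> le m x) /\
  (forall y, (forall x, A x -> le y x) -> le y m).

(* The lattice order is recovered from the binary join: the semilattice laws
   make [join_le crl_add] a partial order whose binary join is [crl_add]. *)
Record completeResiduatedLattice (W : Type) := CompleteResiduatedLattice {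
  crl_sum : set W -> W;
  crl_add : W -> W -> W;
  crl_mul : W -> W -> W;
  crl_res : W -> W -> W;
  crl_zero : W;
  crl_one : W;
  crl_addA : associative crl_add;
  crl_addC : commutative crl_add;
  crl_addxx : idempotent_op crl_add;
  crl_sum_lub : forall A : set W,
    is_least_upper_bound (join_le crl_add) A (crl_sum A);
  crl_inf_ex : forall A : set W,
    exists m : W, is_greatest_lower_bound (join_le crl_add) A m;
  crl_zero_le : forall x, join_le crl_add crl_zero x;
  crl_le_one : forall x, join_le crl_add x crl_one;
  crl_mulA : associative crl_mul;
  crl_mul1x : left_id crl_one crl_mul;
  crl_mulx1 : right_id crl_one crl_mul;
  crl_mul_sumr : forall (a : W) (B : set W),
    crl_mul a (crl_sum B) = crl_sum [set crl_mul a b | b in B];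
  crl_mul_suml : forall (A : set W) (b : W),
    crl_mul (crl_sum A) b = crl_sum [set crl_mul a b | a in A];
  crl_residuation : forall a b c : W,
    join_le crl_add (crl_mul a b) c <-> join_le crl_add b (crl_res a c)
}.

(* [gkat_imp] is defined on tests only: a set used as a type denotes the
   subtype of its elements. *)
Record gkatSignature := GkatSignature {
  gkat_carrier : Type;
  gkat_test : set gkat_carrier;
  gkat_add : gkat_carrier -> gkat_carrier -> gkat_carrier;
  gkat_mul : gkat_carrier -> gkat_carrier -> gkat_carrier;
  gkat_star : gkat_carrier -> gkat_carrier;
  gkat_imp : gkat_test -> gkat_test -> gkat_test;
  gkat_zero : gkat_carrier;
  gkat_one : gkat_carrier
}.

Definition gkat_le (G : gkatSignature) : gkat_carrier G -> gkat_carrier G -> Prop :=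
  join_le (@gkat_add G).

Record is_GKAT (G : gkatSignature) : Prop := IsGKAT {
  gkat_test0 : gkat_test (gkat_zero G);
  gkat_test1 : gkat_test (gkat_one G);
  gkat_testD : forall a b : gkat_carrier G,
    gkat_test a -> gkat_test b -> gkat_test (gkat_add a b);
  gkat_testM : forall a b : gkat_carrier G,
    gkat_test a -> gkat_test b -> gkat_test (gkat_mul a b);
  gkat_addA : associative (@gkat_add G);
  gkat_addC : commutative (@gkat_add G);
  gkat_mulA : associative (@gkat_mul G);
  gkat_mulx1 : right_id (gkat_one G) (@gkat_mul G);
  gkat_mul1x : left_id (gkat_one G) (@gkat_mul G);
  gkat_mulDr : right_distributive (@gkat_mul G) (@gkat_add G);
  gkat_mulDl : left_distributive (@gkat_mul G) (@gkat_add G);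
  gkat_mulx0 : right_zero (gkat_zero G) (@gkat_mul G);
  gkat_mul0x : left_zero (gkat_zero G) (@gkat_mul G);
  gkat_star_unfold : forall p : gkat_carrier G,
    gkat_add (gkat_one G) (gkat_mul p (gkat_star p)) = gkat_star p;
  gkat_star_indl : forall p q r : gkat_carrier G,
    gkat_le (gkat_add q (gkat_mul p r)) r -> gkat_le (gkat_mul (gkat_star p) q) r;
  gkat_star_indr : forall p q r : gkat_carrier G,
    gkat_le (gkat_add q (gkat_mul r p)) r -> gkat_le (gkat_mul q (gkat_star p)) r;
  gkat_residuation : forall a b c : @gkat_test G,
    gkat_le (gkat_mul (sval a) (sval b)) (sval c) <->
    gkat_le (sval b) (sval (gkat_imp a c));
  gkat_test_le1 : forall a : gkat_carrier G,
    gkat_test a -> gkat_le a (gkat_one G);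
  gkat_test_mulC : forall a b : gkat_carrier G,
    gkat_test a -> gkat_test b -> gkat_mul a b = gkat_mul b a
}.

Record is_IGKAT (G : gkatSignature) : Prop := IsIGKAT {
  igkat_gkat : is_GKAT G;
  igkat_test_mulxx : forall a : gkat_carrier G,
    gkat_test a -> gkat_mul a a = a
}.

Section FuzzyLanguages.
Variables (K : Type) (T : set K).
Variables (RK : completeResiduatedLattice K) (RT : completeResiduatedLattice T).
Variable Sigma : Type.

Definition fuzzyLang := seq Sigma -> K.

Definition fl_union (l1 l2 : fuzzyLang) : fuzzyLang :=
  fun w => crl_add RK (l1 w) (l2 w).

Definition fl_cat (l1 l2 : fuzzyLang) : fuzzyLang := fun w =>
  crl_sum RK [set x | exists u v, w = u ++ v /\ x = crl_mul RK (l1 u) (l2 v)].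

Definition fl_empty : fuzzyLang := fun _ => crl_zero RK.

Definition fl_eps : fuzzyLang :=
  fun w => if w is [::] then crl_one RK else crl_zero RK.

Fixpoint fl_pow (l : fuzzyLang) (k : nat) : fuzzyLang :=
  if k is k'.+1 then fl_cat (fl_pow l k') l else fl_eps.

Definition fl_star (l : fuzzyLang) : fuzzyLang :=
  fun w => crl_sum RK [set x | exists k : nat, x = fl_pow l k w].

(* The zero here is that of T; it agrees with the zero of K as soon as the
   structure of T restricts that of K. *)
Definition fl_test : set fuzzyLang := [set l : fuzzyLang |
  (forall w, T (l w)) /\ (forall w, w <> [::] -> l w = sval (crl_zero RT))].

Definition fl_test_at (i : fl_test) (w : seq Sigma) : T :=
  SigSub (mem_set (proj1 (set_mem (valP i)) w)).

Definition fl_imp_fun (i1 i2 : fl_test) : fuzzyLang := fun w =>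
  if w is [::] then sval (crl_res RT (fl_test_at i1 [::]) (fl_test_at i2 [::]))
  else sval (crl_zero RT).

Lemma fl_imp_fun_test (i1 i2 : fl_test) : fl_test (fl_imp_fun i1 i2).
Proof. by split=> [[|x w]|[|x w]] //=; apply: set_mem; apply: valP. Qed.

Definition fl_imp (i1 i2 : fl_test) : fl_test :=
  SigSub (mem_set (fl_imp_fun_test i1 i2)).

Definition FLANG : gkatSignature :=
  GkatSignature fl_union fl_cat fl_star fl_imp fl_empty fl_eps.

End FuzzyLanguages.

(* Main.v *)
(** Every identity of the signature is an equality of joins, so it is obtained
    by comparing upper bounds: since multiplication distributes over arbitrary
    joins, an upper bound of a product of languages at a word is an upper bound
    of the products over the factorizations of that word. The star laws then
    follow by induction on the powers. Tests vanish on nonempty words, so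
    on tests everything reduces to the value at the empty word. *)

Require Import Defs.
From mathcomp Require Import all_boot.
From mathcomp Require Import boolp classical_sets.

Set Implicit Arguments.
Unset Strict Implicit.
Unset Printing Implicit Defensive.

Local Open Scope classical_set_scope.

(** * Order, joins and distributivity in a complete residuated lattice *)

Section CompleteResiduatedLattices.
Variables (W : Type) (R : completeResiduatedLattice W).

Local Notation le := (join_le (crl_add R)).
Local Notation "x + y" := (crl_add R x y).
Local Notation "x * y" := (crl_mul R x y).

Lemma crl_le_refl x : le x x.
Proof. by rewrite /join_le crl_addxx. Qed.

Lemma crl_le_trans y x z : le x y -> le y z -> le x z.
Proof. by rewrite /join_le => xy <-; rewrite crl_addA xy. Qed.

Lemma crl_le_anti x y : le x y -> le y x -> x = y.
Proof. by rewrite /join_le => xy yx; rewrite -xy crl_addC yx. Qed.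

(** Taking [z] to be [y] and then [x] gives both inequalities. Language identities are proved this
    way, without ever manipulating the joins as sets. *)
Lemma crl_eq_ub x y : (forall z, le x z <-> le y z) -> x = y.
Proof.
move=> xy; apply: crl_le_anti.
  by rewrite xy; exact: crl_le_refl.
by rewrite -xy; exact: crl_le_refl.
Qed.

Lemma crl_le_sum (A : set W) y :
  le (crl_sum R A) y <-> forall x, A x -> le x y.
Proof.
have [ub lub] := crl_sum_lub R A; split=> [Ay x Ax|]; last exact: lub.
exact: crl_le_trans (ub x Ax) Ay.
Qed.

Lemma crl_le_add x y z : le (x + y) z <-> le x z /\ le y z.
Proof.
split=> [xyz|[xz yz]]; last by rewrite /join_le -crl_addA yz.
split; apply: crl_le_trans xyz; rewrite /join_le.
  by rewrite crl_addA crl_addxx.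
by rewrite crl_addC -crl_addA crl_addxx.
Qed.

Lemma crl_le_mul_sumr a (B : set W) y :
  le (a * crl_sum R B) y <-> forall b, B b -> le (a * b) y.
Proof.
rewrite crl_mul_sumr crl_le_sum; split=> [h b Bb|h _ [b Bb <-]]; last exact: h.
by apply: h; exists b.
Qed.

Lemma crl_le_mul_suml (A : set W) b y :
  le (crl_sum R A * b) y <-> forall a, A a -> le (a * b) y.
Proof.
rewrite crl_mul_suml crl_le_sum; split=> [h a Aa|h _ [a Aa <-]]; last exact: h.
by apply: h; exists a.
Qed.

(** Lets distributivity over [+] be read off from the axioms for arbitrary joins. *)
Lemma crl_add_sum x y : x + y = crl_sum R [set x; y].
Proof.
apply: crl_eq_ub => z; rewrite crl_le_add crl_le_sum.
by split=> [[xz yz] _ [->|->]//|h]; split; apply: h; [left|right].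
Qed.

(** Makes annihilation by zero the empty case of distributivity. *)
Lemma crl_zero_sum : crl_zero R = crl_sum R set0.
Proof.
by apply: crl_le_anti; [exact: crl_zero_le|apply/crl_le_sum].
Qed.

Lemma crl_mulx0 x : x * crl_zero R = crl_zero R.
Proof. by rewrite crl_zero_sum crl_mul_sumr image_set0. Qed.

Lemma crl_mul0x x : crl_zero R * x = crl_zero R.
Proof. by rewrite crl_zero_sum crl_mul_suml image_set0. Qed.

Lemma crl_mulDr a b c : a * (b + c) = a * b + a * c.
Proof.
by rewrite [b + c]crl_add_sum crl_mul_sumr image_setU !image_set1 -crl_add_sum.
Qed.

Lemma crl_mulDl a b c : (a + b) * c = a * c + b * c.
Proof.
by rewrite [a + b]crl_add_sum crl_mul_suml image_setU !image_set1 -crl_add_sum.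
Qed.

Lemma crl_le_mul a b c d : le a b -> le c d -> le (a * c) (b * d).
Proof.
move=> ab cd; apply: (@crl_le_trans (b * c)); rewrite /join_le.
  by rewrite -crl_mulDl ab.
by rewrite -crl_mulDr cd.
Qed.

End CompleteResiduatedLattices.

(** * Fuzzy languages under union and concatenation *)

Section FuzzyLanguageAlgebra.
Variables (K : Type) (RK : completeResiduatedLattice K) (Sigma : Type).

Local Notation lang := (fuzzyLang K Sigma).
Local Notation le := (join_le (crl_add RK)).
Local Notation "x * y" := (crl_mul RK x y).
Local Notation "l1 <=l l2" := (join_le (@fl_union K RK Sigma) l1 l2)
  (at level 70).
Local Notation "l1 ** l2" := (fl_cat RK l1 l2) (at level 40).

Implicit Types (l p q r : lang) (w u v : seq Sigma).

Lemma fl_leP l1 l2 : l1 <=l l2 <-> forall w, le (l1 w) (l2 w).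
Proof.
by split=> [h w|h]; [rewrite /join_le -[in RHS]h|apply: funext => w; exact: h].
Qed.

Lemma fl_le_refl l : l <=l l.
Proof. by apply/fl_leP => w; exact: crl_le_refl. Qed.

Lemma fl_le_trans l2 l1 l3 : l1 <=l l2 -> l2 <=l l3 -> l1 <=l l3.
Proof.
move=> /fl_leP h12 /fl_leP h23; apply/fl_leP => w.
exact: crl_le_trans (h12 w) (h23 w).
Qed.

Lemma fl_le_anti l1 l2 : l1 <=l l2 -> l2 <=l l1 -> l1 = l2.
Proof.
by move=> /fl_leP h12 /fl_leP h21; apply: funext => w; exact: crl_le_anti.
Qed.

Lemma fl_le_union l1 l2 l3 :
  fl_union RK l1 l2 <=l l3 <-> l1 <=l l3 /\ l2 <=l l3.
Proof.
rewrite !fl_leP; split=> [h|[h1 h2] w]; last by apply/crl_le_add; split.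
by split=> w; have /crl_le_add[] := h w.
Qed.

Lemma fl_cat_le_at l1 l2 w y :
  le ((l1 ** l2) w) y <-> forall u v, w = u ++ v -> le (l1 u * l2 v) y.
Proof.
rewrite crl_le_sum; split=> [h u v wE|h _ [u [v [wE ->]]]]; last exact: h.
by apply: h; exists u, v.
Qed.

Lemma fl_cat_le l1 l2 l3 :
  l1 ** l2 <=l l3 <-> forall u v, le (l1 u * l2 v) (l3 (u ++ v)).
Proof.
rewrite fl_leP; split=> [h u v|h w].
  by have /fl_cat_le_at := h (u ++ v); apply.
by apply/fl_cat_le_at => u v ->.
Qed.

Lemma fl_cat_mono l1 l2 l3 l4 : l1 <=l l2 -> l3 <=l l4 -> l1 ** l3 <=l l2 ** l4.
Proof.
move=> /fl_leP h12 /fl_leP h34; apply/fl_cat_le => u v.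
apply: crl_le_trans (crl_le_mul (h12 u) (h34 v)) _.
(* Reflexivity of [l2 ** l4], read through [fl_cat_le], bounds each of its own products. *)
exact: (proj1 (fl_cat_le _ _ _) (fl_le_refl _)).
Qed.

(** Either side is below [y] exactly when every triple product over a factorization of [w] into
    three words is; the two directions only regroup the factors. *)
Lemma fl_catA : associative (@fl_cat K RK Sigma).
Proof.
move=> l1 l2 l3; apply: funext => w; apply: (crl_eq_ub (R := RK)) => y.
rewrite !fl_cat_le_at; split=> h u v wE.
  apply/crl_le_mul_suml => _ [u1 [u2 [uE ->]]]; rewrite -crl_mulA.
  have wE' : w = u1 ++ (u2 ++ v) by rewrite wE uE catA.
  by have /crl_le_mul_sumr := h _ _ wE'; apply; exists u2, v.
apply/crl_le_mul_sumr => _ [v1 [v2 [vE ->]]]; rewrite crl_mulA.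
have wE' : w = (u ++ v1) ++ v2 by rewrite wE vE catA.
by have /crl_le_mul_suml := h _ _ wE'; apply; exists u, v1.
Qed.

Lemma fl_catx1 : right_id (@fl_eps K RK Sigma) (@fl_cat K RK Sigma).
Proof.
move=> l; apply: funext => w; apply: (crl_eq_ub (R := RK)) => y.
(* Only the factorization with an empty second factor matters: any other one meets [fl_eps] at a
   nonempty word and contributes zero. *)
rewrite fl_cat_le_at; split=> [h|h u [|a v] wE] /=.
- by have := h w [::]; rewrite cats0 /= crl_mulx1; apply.
- by move: wE h; rewrite cats0 crl_mulx1 => ->.
- by rewrite crl_mulx0; exact: crl_zero_le.
Qed.

Lemma fl_cat1x : left_id (@fl_eps K RK Sigma) (@fl_cat K RK Sigma).
Proof.
move=> l; apply: funext => w; apply: (crl_eq_ub (R := RK)) => y.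
rewrite fl_cat_le_at; split=> [h|h [|a u] v wE] /=.
- by have := h [::] w; rewrite /= crl_mul1x; apply.
- by move: wE h; rewrite /= crl_mul1x => ->.
- by rewrite crl_mul0x; exact: crl_zero_le.
Qed.

Lemma fl_catDr : right_distributive (@fl_cat K RK Sigma) (@fl_union K RK Sigma).
Proof.
move=> l1 l2 l3; apply: funext => w; apply: (crl_eq_ub (R := RK)) => y.
rewrite crl_le_add !fl_cat_le_at; split=> [h|[h2 h3] u v wE].
  by split=> u v /h; rewrite crl_mulDr crl_le_add => -[].
by rewrite crl_mulDr crl_le_add; split; [exact: h2|exact: h3].
Qed.

Lemma fl_catDl : left_distributive (@fl_cat K RK Sigma) (@fl_union K RK Sigma).
Proof.
move=> l1 l2 l3; apply: funext => w; apply: (crl_eq_ub (R := RK)) => y.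
rewrite crl_le_add !fl_cat_le_at; split=> [h|[h1 h2] u v wE].
  by split=> u v /h; rewrite crl_mulDl crl_le_add => -[].
by rewrite crl_mulDl crl_le_add; split; [exact: h1|exact: h2].
Qed.

Lemma fl_catx0 : right_zero (@fl_empty K RK Sigma) (@fl_cat K RK Sigma).
Proof.
move=> l; apply: funext => w; apply: (crl_le_anti (R := RK)).
  by apply/fl_cat_le_at => u v _; rewrite crl_mulx0; exact: crl_le_refl.
exact: crl_zero_le.
Qed.

Lemma fl_cat0x : left_zero (@fl_empty K RK Sigma) (@fl_cat K RK Sigma).
Proof.
move=> l; apply: funext => w; apply: (crl_le_anti (R := RK)).
  by apply/fl_cat_le_at => u v _; rewrite crl_mul0x; exact: crl_le_refl.
exact: crl_zero_le.
Qed.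

(** * Powers and the star *)

(** [fl_pow] adds factors on the right, whereas the unfolding law of the star needs them on the
    left. *)
Lemma fl_powSl p k : p ** fl_pow RK p k = fl_pow RK p k.+1.
Proof.
elim: k => [|k IHk] /=; first by rewrite fl_catx1 fl_cat1x.
by rewrite fl_catA IHk.
Qed.

Lemma fl_pow_le_star p k : fl_pow RK p k <=l fl_star RK p.
Proof.
apply/fl_leP => w.
by apply: (proj1 (crl_le_sum RK _ _) (crl_le_refl RK _)); exists k.
Qed.

Lemma fl_star_le p r : (forall k, fl_pow RK p k <=l r) -> fl_star RK p <=l r.
Proof.
move=> h; apply/fl_leP => w; apply/crl_le_sum => _ [k ->].
by have /fl_leP := h k.
Qed.

(** Half of star-continuity: multiplication distributes over the join of powers that defines the
    star at each word, so a bound can be checked power by power. *)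
Lemma fl_star_cat_le p q r :
  (forall k, fl_pow RK p k ** q <=l r) -> fl_star RK p ** q <=l r.
Proof.
move=> h; apply/fl_cat_le => u v; apply/crl_le_mul_suml => _ [k ->].
by have /fl_cat_le := h k.
Qed.

Lemma fl_cat_star_le p q r :
  (forall k, q ** fl_pow RK p k <=l r) -> q ** fl_star RK p <=l r.
Proof.
move=> h; apply/fl_cat_le => u v; apply/crl_le_mul_sumr => _ [k ->].
by have /fl_cat_le := h k.
Qed.

Lemma fl_star_unfold p :
  fl_union RK (fl_eps RK (Sigma:=Sigma)) (p ** fl_star RK p) = fl_star RK p.
Proof.
(* Both members of the union lie below it; [le1] will bound the zeroth power and [leS] all the later
   ones. *)
have [le1 leS] := proj1 (fl_le_union _ _ _) (fl_le_refl
  (fl_union RK (fl_eps RK (Sigma:=Sigma)) (p ** fl_star RK p))).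
apply: fl_le_anti.
  apply/fl_le_union; split; first exact: (fl_pow_le_star p 0).
  by apply: fl_cat_star_le => k; rewrite fl_powSl; exact: fl_pow_le_star.
apply: fl_star_le => -[|k]; first exact: le1.
rewrite -fl_powSl; apply: fl_le_trans leS.
by apply: fl_cat_mono; [exact: fl_le_refl|exact: fl_pow_le_star].
Qed.

(** Since $q \leq r$, it suffices to bound $p^k;r$ by $r$, which follows by induction from
    $p^{k+1};r = p^k;(p;r) \leq p^k;r$. *)
Lemma fl_star_indl p q r :
  fl_union RK q (p ** r) <=l r -> fl_star RK p ** q <=l r.
Proof.
move=> /fl_le_union[qr prr]; apply: fl_star_cat_le => k.
apply: (@fl_le_trans (fl_pow RK p k ** r)).
  by apply: fl_cat_mono => //; exact: fl_le_refl.
elim: k => [|k IHk] /=; first by rewrite fl_cat1x; exact: fl_le_refl.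
rewrite -fl_catA; apply: fl_le_trans IHk.
by apply: fl_cat_mono => //; exact: fl_le_refl.
Qed.

(** By induction $q;p^{k+1} = (q;p^k);p \leq r;p \leq r$. *)
Lemma fl_star_indr p q r :
  fl_union RK q (r ** p) <=l r -> q ** fl_star RK p <=l r.
Proof.
move=> /fl_le_union[qr rpr]; apply: fl_cat_star_le.
elim=> [|k IHk] /=; first by rewrite fl_catx1.
rewrite fl_catA; apply: fl_le_trans rpr.
by apply: fl_cat_mono => //; exact: fl_le_refl.
Qed.

(** The empty word factors only trivially, and every factorization of a nonempty word has a nonempty
    factor, which makes its product zero. *)
Lemma fl_cat_supp_nil l1 l2 :
  (forall w, w <> [::] -> l1 w = crl_zero RK) ->
  (forall w, w <> [::] -> l2 w = crl_zero RK) ->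
  l1 ** l2 = fun w => if w is [::] then l1 [::] * l2 [::] else crl_zero RK.
Proof.
move=> z1 z2; apply: funext => w; apply: (crl_eq_ub (R := RK)) => y.
rewrite fl_cat_le_at; case: w => [|a w]; split=> h.
- exact: h.
- by case=> [|//] [|//].
- exact: crl_zero_le.
- case=> [|b u] v wE.
    by rewrite [l2 v]z2 ?crl_mulx0 // => v0; rewrite v0 in wE.
  by rewrite [l1 _]z1 ?crl_mul0x.
Qed.

End FuzzyLanguageAlgebra.

(** * Transfer of the test axioms from [RT] to languages *)

Theorem theorem5 (K : Type) (T : set K)
  (RK : completeResiduatedLattice K) (RT : completeResiduatedLattice T)
  (T_add : forall a b : T, sval (crl_add RT a b) = crl_add RK (sval a) (sval b))
  (T_mul : forall a b : T, sval (crl_mul RT a b) = crl_mul RK (sval a) (sval b))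
  (T_zero : sval (crl_zero RT) = crl_zero RK)
  (T_one : sval (crl_one RT) = crl_one RK)
  (T_mulC : forall a b : K, T a -> T b -> crl_mul RK a b = crl_mul RK b a)
  (T_mulxx : forall a : K, T a -> crl_mul RK a a = a)
  (Sigma : Type) :
  is_IGKAT (FLANG RK RT Sigma).
Proof.
have T_sval (a : T) : T (sval a) by apply: set_mem; exact: valP.
have T0 : T (crl_zero RK) by rewrite -T_zero.
have T1 : T (crl_one RK) by rewrite -T_one.
(* Closure of [T] comes from computing in the subtype, where [RT] already returns elements of
   [T]. *)
have TD a b : T a -> T b -> T (crl_add RK a b).
  move=> Ta Tb.
  by have := T_sval (crl_add RT (SigSub (mem_set Ta)) (SigSub (mem_set Tb)));
    rewrite T_add.
have TM a b : T a -> T b -> T (crl_mul RK a b).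
  move=> Ta Tb.
  by have := T_sval (crl_mul RT (SigSub (mem_set Ta)) (SigSub (mem_set Tb)));
    rewrite T_mul.
(* The residuum of tests is that of [RT], so its adjunction has to be carried from the order of [RT]
   to that of [RK]. *)
have T_le (a b : T) :
    join_le (crl_add RT) a b <-> join_le (crl_add RK) (sval a) (sval b).
  by rewrite /join_le -T_add; split=> [->//|/val_inj].
have supp a : fl_test RT (Sigma:=Sigma) a ->
    forall w, w <> [::] -> a w = crl_zero RK.
  by rewrite -T_zero => -[].
have catE a b : fl_test RT (Sigma:=Sigma) a -> fl_test RT b -> fl_cat RK a b =
    fun w => if w is [::] then crl_mul RK (a [::]) (b [::]) else crl_zero RK.
  by move=> /supp sa /supp sb; exact: fl_cat_supp_nil.
split; last first.
  move=> a ta /=; rewrite catE //; apply: funext => -[|x w].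
    by apply: T_mulxx; case: ta.
  by rewrite (supp _ ta).
split=> /=.
- by split=> // w _; rewrite T_zero.
- by split=> [[]|[]].
- move=> a b ta tb; split=> [w|w w0]; first by apply: TD; [case: ta|case: tb].
  by rewrite /fl_union (supp _ ta) // (supp _ tb) // T_zero crl_addxx.
- move=> a b ta tb; rewrite catE //; split=> [[|x w]|[]//] //.
  by apply: TM; [case: ta|case: tb].
- by move=> a b c; apply: funext => w; exact: crl_addA.
- by move=> a b; apply: funext => w; exact: crl_addC.
- exact: fl_catA.
- exact: fl_catx1.
- exact: fl_cat1x.
- exact: fl_catDr.
- exact: fl_catDl.
- exact: fl_catx0.
- exact: fl_cat0x.
- exact: fl_star_unfold.
- exact: fl_star_indl.
- exact: fl_star_indr.
(* At the empty word this is residuation in [RT]; at a nonempty word the left member of either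
   inequality is zero. *)
- move=> a b c; rewrite /gkat_le /= !fl_leP.
  have ta := set_mem (valP a); have tb := set_mem (valP b).
  have tc := set_mem (valP c).
  rewrite catE //.
  have := crl_residuation RT (fl_test_at a [::]) (fl_test_at b [::])
    (fl_test_at c [::]).
  rewrite !T_le T_mul /= => res.
  split=> h [|x w] /=.
  + exact: (proj1 res (h [::])).
  + by rewrite (supp _ tb) //; exact: crl_zero_le.
  + exact: (proj2 res (h [::])).
  + exact: crl_zero_le.
- move=> a ta; apply/fl_leP => -[|x w] /=; first exact: crl_le_one.
  by rewrite (supp _ ta) //; exact: crl_le_refl.
- move=> a b ta tb; rewrite !catE //; apply: funext => -[|//].
  by apply: T_mulC; [case: ta|case: tb].
Qed.
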